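(* Let $1 \le s < t$, let $M_0, M_1, \ldots, M_{t-1}$ be linear orders each equal to $\omega$ or $\omega^*$ which alternate (i.e. $M_{i+1} \neq M_i$), and let $m_i$ ($i<s$) and $n_j$ ($j<t$) be non-zero natural numbers. Let $A = M_0^{m_0} \cdot M_1^{m_1} \cdots M_{s-1}^{m_{s-1}}$ and $B = M_0^{n_0} \cdot M_1^{n_1} \cdots M_{t-1}^{n_{t-1}}$. Let $u$ be the smallest $i < s$ such that $m_i \neq n_i$, or $u = s$ if $m_i = n_i$ for all $i < s$. Then: (i) if $u = s$ or $u = s-1$, then $l(A,B) = 2(m_0 + m_1 + \cdots + m_{s-2}) + 1$ (the sum being empty, hence $l(A,B)=1$, when $s=1$); (ii) if $u = s-2$ and $m_{s-2} < n_{s-2}$, then $l(A,B) = 2(m_0 + \cdots + m_{s-3} + m_{s-2}) + 1$, and if $u = s-2$ and $n_{s-2} < m_{s-2}$, then $l(A,B) = 2(m_0 + \cdots + m_{s-3} + n_{s-2}) + 2$; (iii) if $u < s-2$, then $l(A,B) = 2(m_0 + m_1 + \cdots + m_{u-1} + \min(m_u, n_u)) + 2$.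
   Context: All orders are linear orders. $\omega^*$ is the reverse of $\omega$. For linear orders $X, Y$, $X \cdot Y$ denotes the anti-lexicographic product (''$Y$ copies of $X$''): pairs $(x,y)$, $x\in X$, $y \in Y$, compared first by $y$, then by $x$. $M^n$ denotes the product of $n$ copies of $M$. For $n \ge 1$, $X \equiv_n Y$ means player II has a winning strategy in the $n$-move Ehrenfeucht–Fraïssé game on $X$ and $Y$ (each move: I picks an element of either structure, II an element of the other; II wins if the correspondence between chosen elements is an order-isomorphism of the induced substructures). $X \equiv Y$ iff $X \equiv_n Y$ for all $n$. For $X \not\equiv Y$, $l(X,Y)$ is the non-zero natural number $n$ with $X \equiv_n Y$ and $X \not\equiv_{n+1} Y$. *)

(* Defs.v *)
From mathcomp Require Import all_boot all_order.

Set Implicit Arguments.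
Unset Strict Implicit.
Unset Printing Implicit Defensive.

Import Order.TTheory.

(* Bundling the display lets products of varying length live in one type. *)
Record linorder := LinOrder {
  lo_disp : Order.disp_t;
  lo_sort :> orderType lo_disp
}.

(* [Omega] stands for omega (nat) and [OmegaStar] for its reverse. *)
Inductive omega_kind := Omega | OmegaStar.

Definition omega_order (k : omega_kind) : linorder :=
  match k with
  | Omega => LinOrder nat
  | OmegaStar => LinOrder nat^d
  end.

(* The anti-lexicographic product X . Y, i.e. Y copies of X.  The library's
   order on pairs looks at the first component first, so the pair (x, y) with
   x in X and y in Y is encoded as (y, x). *)
Definition lprod (X Y : linorder) : linorder :=
  LinOrder (Y *lexi[lo_disp Y] X).

(* The one-point order, neutral for [lprod] up to isomorphism. *)
Definition lone : linorder := LinOrder 'I_1.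

(* F 0 . F 1 ... F (k - 1) *)
Fixpoint lprodn (F : nat -> linorder) (k : nat) : linorder :=
  if k is k'.+1 then lprod (lprodn F k') (F k') else lone.

Definition lpow (X : linorder) (k : nat) : linorder := lprodn (fun=> X) k.

Section EhrenfeuchtFraisse.

Variables X Y : linorder.

(* Player II's reply to a move in X (resp. Y), given the list of pairs chosen
   in the earlier rounds. *)
Record strategy := Strategy {
  reply_to_left : seq (X * Y) -> X -> Y;
  reply_to_right : seq (X * Y) -> Y -> X
}.

Definition round (sigma : strategy) (p : seq (X * Y)) (move : X + Y) :
    seq (X * Y) :=
  match move with
  | inl x => rcons p (x, reply_to_left sigma p x)
  | inr y => rcons p (reply_to_right sigma p y, y)
  end.

Definition play (sigma : strategy) (moves : seq (X + Y)) : seq (X * Y) :=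
  foldl (round sigma) [::] moves.

(* Preservation and reflection of = say that p is the graph of a bijection
   between the chosen elements. *)
Definition order_iso (p : seq (X * Y)) : Prop :=
  forall a b, a \in p -> b \in p ->
    (a.1 = b.1 <-> a.2 = b.2) /\ ((a.1 < b.1)%O <-> (a.2 < b.2)%O).

Definition winning (n : nat) (sigma : strategy) : Prop :=
  forall moves : seq (X + Y), size moves = n -> order_iso (play sigma moves).

Definition EF_equiv (n : nat) : Prop := exists sigma, winning n sigma.

(* [is_l n] is l(X, Y) = n; [is_l_unique] shows that n is then determined. *)
Definition is_l (n : nat) : Prop :=
  [/\ 0 < n, EF_equiv n & ~ EF_equiv n.+1].

Lemma play_rcons sigma moves v :
  play sigma (rcons moves v) = round sigma (play sigma moves) v.
Proof. by rewrite /play -cats1 foldl_cat. Qed.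

Lemma mem_round sigma p v c : c \in p -> c \in round sigma p v.
Proof. by case: v => z cp; rewrite mem_rcons inE cp orbT. Qed.

Lemma EF_equivW n : 0 < n -> EF_equiv n.+1 -> EF_equiv n.
Proof.
case: n => // n _ [sigma win]; exists sigma => moves sz_moves a b ap bp.
case: moves sz_moves ap bp => // v moves sz_moves ap bp.
have sz_rcons : size (rcons (v :: moves) v) = n.+2 by rewrite size_rcons sz_moves.
by apply: (win _ sz_rcons); rewrite play_rcons mem_round.
Qed.

Lemma EF_equiv_le m n : 0 < m -> m <= n -> EF_equiv n -> EF_equiv m.
Proof.
move=> m_gt0; elim: n => [|n IHn]; first by rewrite leqNgt m_gt0.
rewrite leq_eqVlt ltnS => /orP[/eqP-> //|le_mn] eqn.
by apply: IHn => //; apply: EF_equivW eqn; apply: leq_trans le_mn.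
Qed.

Lemma is_l_unique m n : is_l m -> is_l n -> m = n.
Proof.
move=> [m_gt0 eqm neqm] [n_gt0 eqn neqn].
case: (ltngtP m n) => // lt_mn.
- by case: neqm; apply: EF_equiv_le eqn.
- by case: neqn; apply: EF_equiv_le eqm.
Qed.

End EhrenfeuchtFraisse.

(* The smallest i < s with m i <> n i, or s if there is none. *)
Definition first_diff (s : nat) (m n : nat -> nat) : nat :=
  find (fun i => m i != n i) (iota 0 s).

(* Main.v *)
(** Write A and B as words in omega and omega^*, innermost factor first.
    Passing from X, Y to omega.X, omega.Y raises the number of moves that II
    survives by exactly 2, provided that neither X nor Y has a least element.
    Upper bound: the points of omega.X without immediate predecessor form a copy
    of X, and I needs two moves to punish a reply that confuses them with other
    points.  Lower bound: II plays in X, Y and copies the offset inside the copy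
    of omega; two further moves cannot do harm, because any two points of the
    position that lie in distinct copies are separated by an infinite gap.
    The same holds for omega^*, with greatest elements.  After removal of the
    common prefix the words are told apart either by an endpoint (2 moves), when
    one of them has a single kind of letter, or, when both have both kinds but
    start differently, by an immediate predecessor (3 moves, not 2). *)
Require Import Defs.
From mathcomp Require Import all_boot all_order.
From mathcomp Require Import zify.
From Stdlib Require Import ClassicalEpsilon.

Set Implicit Arguments.
Unset Strict Implicit.
Unset Printing Implicit Defensive.

Import Order.TTheory.

(** * Back-and-forth conditions for arbitrary relations *)

Section BackAndForth.

Variables (X Y : eqType) (rX : rel X) (rY : rel Y).

(** Equality of entries is recovered from the relation by totality, in [order_isoP] and
    [partial_iso_eq]. *)
Definition partial_iso (p : seq (X * Y)) : Prop :=
  {in p &, forall a b, rX a.1 b.1 = rY a.2 b.2}.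

Fixpoint bf (n : nat) (p : seq (X * Y)) : Prop :=
  partial_iso p /\
  if n is n'.+1 then
    (forall x, exists y, bf n' (rcons p (x, y))) /\
    (forall y, exists x, bf n' (rcons p (x, y)))
  else True.

Lemma bf_iso n p : bf n p -> partial_iso p.
Proof. by case: n => [|n] []. Qed.

Lemma bf_forth n p x : bf n.+1 p -> exists y, bf n (rcons p (x, y)).
Proof. by case=> _ [forth _]; apply: forth. Qed.

Lemma bf_back n p y : bf n.+1 p -> exists x, bf n (rcons p (x, y)).
Proof. by case=> _ [_ back]; apply: back. Qed.

Lemma bfW n p : bf n.+1 p -> bf n p.
Proof.
elim: n p => [|n IHn] p [iso_p [forth back]]; first by split.
split=> //; split=> [x|y].
- by have [y /IHn bfy] := forth x; exists y.
- by have [x /IHn bfx] := back y; exists x.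
Qed.

Lemma bf_le m n p : m <= n -> bf n p -> bf m p.
Proof.
elim: n => [|n IHn]; first by rewrite leqn0 => /eqP->.
by rewrite leq_eqVlt => /predU1P[-> //|/IHn le_mn /bfW/le_mn].
Qed.

Lemma partial_iso_sub p q :
  {subset p <= q} -> partial_iso q -> partial_iso p.
Proof. by move=> sub_pq iso_q a b /sub_pq ap /sub_pq bp; apply: iso_q. Qed.

Lemma partial_iso_rcons p c : irreflexive rX -> irreflexive rY ->
    partial_iso p ->
    {in p, forall a, rX a.1 c.1 = rY a.2 c.2 /\ rX c.1 a.1 = rY c.2 a.2} ->
  partial_iso (rcons p c).
Proof.
move=> irrX irrY iso_p iso_c a b; rewrite !mem_rcons !inE.
case/predU1P=> [->|ap] /predU1P[->|bp]; first by rewrite irrX irrY.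
- by have [] := iso_c b bp.
- by have [] := iso_c a ap.
- exact: iso_p.
Qed.

Definition immediate_pred (T : Type) (r : rel T) (x y : T) : Prop :=
  r x y /\ forall z, ~ (r x z /\ r z y).

(** I plays the predecessor [y] of [z']. If something lay between II's reply and [z], I would play
    it next, and II would need a point between [y] and [z']. *)
Lemma bf2_immediate_pred p z z' :
    bf 2 p -> (z, z') \in p ->
  (exists y, immediate_pred rY y z') -> exists x, immediate_pred rX x z.
Proof.
move=> [_ [_ back]] zp [y [lt_y gap_y]].
have [x [iso_x [forth _]]] := back y.
have lastP q (c : X * Y) : c \in rcons q c by rewrite mem_rcons inE eqxx.
have liftP q (c d : X * Y) : d \in q -> d \in rcons q c.
  by rewrite mem_rcons inE => ->; rewrite orbT.
have iso_xz := iso_x _ _ (lastP _ _) (liftP _ _ _ zp).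
exists x; split; first by rewrite iso_xz.
move=> w [lt_xw lt_wz]; have [w' [iso_w _]] := forth w.
have iso_xw := iso_w _ _ (liftP _ _ _ (lastP _ _)) (lastP _ _).
have iso_wz := iso_w _ _ (lastP _ _) (liftP _ _ _ (liftP _ _ _ zp)).
by case: (gap_y w'); split; rewrite -?iso_xw -?iso_wz.
Qed.

End BackAndForth.

Definition swap (X Y : Type) (a : X * Y) : Y * X := (a.2, a.1).

Lemma swapK (X Y : Type) : cancel (@swap X Y) (@swap Y X).
Proof. by case. Qed.

Lemma partial_iso_swap (X Y : eqType) (rX : rel X) (rY : rel Y) p :
  partial_iso rX rY p -> partial_iso rY rX (map (@swap X Y) p).
Proof.
by move=> iso_p _ _ /mapP[a ap ->] /mapP[b bp ->] /=; rewrite iso_p.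
Qed.

Lemma bf_swap (X Y : eqType) (rX : rel X) (rY : rel Y) n p :
  bf rX rY n p -> bf rY rX n (map (@swap X Y) p).
Proof.
elim: n p => [|n IHn] p [iso_p next]; split=> //; try exact: partial_iso_swap.
case: next => forth back; split=> [y|x].
- by have [x /IHn] := back y; rewrite map_rcons; exists x.
- by have [y /IHn] := forth x; rewrite map_rcons; exists y.
Qed.

Lemma bf_converse (X Y : eqType) (rX rX' : rel X) (rY rY' : rel Y) n p :
    (forall x y, rX' x y = rX y x) -> (forall x y, rY' x y = rY y x) ->
  bf rX rY n p -> bf rX' rY' n p.
Proof.
move=> eX eY; elim: n p => [|n IHn] p [iso_p next]; split=> //.
1,2: by move=> a b ap bp; rewrite eX eY iso_p.
case: next => forth back; split=> [x|y].
- by have [y /IHn bfy] := forth x; exists y.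
- by have [x /IHn bfx] := back y; exists x.
Qed.

Definition rel_iso (X X' : Type) (r : rel X) (r' : rel X') : Prop :=
  exists (f : X -> X') (g : X' -> X),
    [/\ cancel f g, cancel g f & forall x y, r' (f x) (f y) = r x y].

Lemma bf_rel_iso (X Y X' Y' : eqType) (rX : rel X) (rY : rel Y)
    (rX' : rel X') (rY' : rel Y') n :
    rel_iso rX rX' -> rel_iso rY rY' ->
  bf rX rY n [::] -> bf rX' rY' n [::].
Proof.
case=> [f [f' [_ ff' fE]]] [g [g' [_ gg' gE]]].
pose h (a : X * Y) := (f a.1, g a.2).
suff bfh q : bf rX rY n q -> bf rX' rY' n (map h q) by move/bfh.
elim: n q => [|n IHn] q [iso_q next]; split=> //.
1,2: by move=> _ _ /mapP[a aq ->] /mapP[b bq ->] /=; rewrite fE gE iso_q.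
case: next => forth back; split=> [x|y].
- have [y /IHn] := forth (f' x); rewrite map_rcons /h /= ff'.
  by exists (g y).
- have [x /IHn] := back (g' y); rewrite map_rcons /h /= gg'.
  by exists (f x).
Qed.

(** * Winning strategies as back-and-forth conditions *)

Section GameStrategy.

Variables X Y : linorder.

Lemma order_isoP (p : seq (X * Y)) :
  order_iso p <-> partial_iso <%O <%O p.
Proof.
split=> iso_p a b ap bp.
  by have [_ [ab ba]] := iso_p a b ap bp; apply/idP/idP.
have eq_ab := iso_p a b ap bp; have eq_ba := iso_p b a bp ap.
split; last by rewrite eq_ab.
split=> eq; move: eq_ab eq_ba; rewrite eq !ltxx.
- by case: ltgtP.
- by case: ltgtP.
Qed.

Lemma play_cat (sigma : strategy X Y) moves moves' :
  {subset play sigma moves <= play sigma (moves ++ moves')}.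
Proof.
elim/last_ind: moves' => [|moves' v IH] c cp; first by rewrite cats0.
by rewrite -rcons_cat play_rcons mem_round // IH.
Qed.

Lemma EF_equiv_bf n (x0 : X) (y0 : Y) :
  EF_equiv X Y n <-> bf <%O <%O n ([::] : seq (X * Y)).
Proof.
split=> [[sigma win]|bf_n].
  have bf_play r moves : size moves + r = n -> bf <%O <%O r (play sigma moves).
    have iso_play r' moves' : size moves' + r' = n ->
        partial_iso <%O <%O (play sigma moves').
      move=> sz.
      (* [winning] speaks of complete plays only, so the play is padded with idle moves [x0] up to
         length [n]; its earlier position inherits the isomorphism. *)
      apply: partial_iso_sub (@play_cat sigma _ (nseq r' (inl x0))) _.
      by apply/order_isoP/win; rewrite size_cat size_nseq.
    elim: r moves => [|r IHr] moves sz; split=> //; try exact: iso_play sz.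
    split=> z.
    - exists (reply_to_left sigma (play sigma moves) z).
      move: (IHr (rcons moves (inl z))); rewrite play_rcons; apply.
      by rewrite size_rcons addSnnS.
    - exists (reply_to_right sigma (play sigma moves) z).
      move: (IHr (rcons moves (inr z))); rewrite play_rcons; apply.
      by rewrite size_rcons addSnnS.
  exact: (bf_play n [::]).
(* II sees only the position, so the number of rounds left after the reply is computed from the
   length of [p]. Choice picks a reply that keeps [bf]. *)
pose left_ p x y := bf <%O <%O (n - (size p).+1) (rcons p (x, y) : seq (X * Y)).
pose sigma := Strategy (fun p x => epsilon (inhabits y0) (left_ p x))
                       (fun p y => epsilon (inhabits x0) (left_ p ^~ y)).
have bf_play moves : size moves <= n ->
    size (play sigma moves) = size moves /\
    bf <%O <%O (n - size moves) (play sigma moves).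
  elim/last_ind: moves => [|moves v IH]; first by rewrite subn0.
  rewrite size_rcons => lt_n; have [sz] := IH (ltnW lt_n).
  rewrite -subnSK // play_rcons => -[_ [forth back]].
  case: v => z; rewrite /round size_rcons sz; split=> //.
  - have ex_y : exists y, left_ (play sigma moves) z y by rewrite /left_ sz.
    by move: (epsilon_spec (inhabits y0) _ ex_y); rewrite {1}/left_ sz.
  - have ex_x : exists x, left_ (play sigma moves) x z by rewrite /left_ sz.
    by move: (epsilon_spec (inhabits x0) _ ex_x); rewrite {1}/left_ sz.
exists sigma => moves sz; apply/order_isoP.
have [|_] := bf_play moves; first by rewrite sz.
exact: bf_iso.
Qed.

End GameStrategy.

(** * Lexicographic products and strict total orders *)

(** The first component dominates, so [lex r ltn] is omega . X, with the copy index written first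
    and the offset second. *)
Definition lex (X Z : eqType) (r : rel X) (s : rel Z) : rel (X * Z) :=
  fun a b => r a.1 b.1 || (a.1 == b.1) && s a.2 b.2.

Definition strict_total (X : eqType) (r : rel X) : Prop :=
  [/\ irreflexive r, transitive r & forall x y, [|| x == y, r x y | r y x]].

Lemma strict_total_lex (X Z : eqType) (r : rel X) (s : rel Z) :
  strict_total r -> strict_total s -> strict_total (lex r s).
Proof.
move=> [irr tr tot] [irs ts tos]; split.
- by move=> [x z]; rewrite /lex /= irr irs andbF.
- move=> [x z] [x' z'] [x'' z'']; rewrite /lex /=.
  case/orP=> [lt1|/andP[/eqP<- lt1]] /orP[lt2|/andP[/eqP<- lt2]].
  + by rewrite (tr _ _ _ lt1 lt2).
  + by rewrite lt1.
  + by rewrite lt2.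
  + by rewrite eqxx (ts _ _ _ lt1 lt2) orbT.
- move=> [x z] [x' z']; rewrite /lex xpair_eqE /=.
  have /or3P[/eqP<-|->|->] := tot x x'; rewrite ?eqxx ?irr ?orbT //=.
Qed.

Lemma strict_total_converse (X : eqType) (r r' : rel X) :
  (forall x y, r' x y = r y x) -> strict_total r -> strict_total r'.
Proof.
move=> eq_r [irr tr tot]; split=> [x|y x z|x y]; rewrite ?eq_r //.
  by move=> lt_yx lt_zy; apply: tr lt_zy lt_yx.
by have /or3P[->|->|->] := tot x y; rewrite ?orbT.
Qed.

Lemma strict_total_ltn : strict_total ltn.
Proof.
split; [exact: ltnn | exact: ltn_trans | move=> x y /=].
by case: ltngtP.
Qed.

Definition no_max (T : Type) (r : rel T) : Prop := forall x, exists y, r x y.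

Definition no_min (T : Type) (r : rel T) : Prop := forall x, exists y, r y x.

(** * Surviving one more move *)

Section Gaps.

Variables (X Y : eqType) (rX : rel X) (rY : rel Y).
Hypotheses (totX : strict_total rX) (totY : strict_total rY).

Lemma lower_neighbour (p : seq (X * Y)) x :
    (exists2 c, c \in p &
      rX c.1 x /\ {in p, forall a, rX a.1 x -> ~~ rX c.1 a.1})
  \/ {in p, forall a, ~~ rX a.1 x}.
Proof.
have [irr tr tot] := totX.
elim: p => [|d p [[c cp [lt_c max_c]]|no_p]]; first by right.
- left; have [lt_d|nlt_d] := boolP (rX d.1 x && rX c.1 d.1).
    have /andP[lt_dx lt_cd] := lt_d.
    exists d; rewrite ?mem_head //; split=> // a; rewrite inE.
    case/predU1P=> [->|ap lt_a]; first by rewrite irr.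
    by apply: contra (max_c a ap lt_a) => /(tr _ _ _ lt_cd).
  exists c; rewrite ?inE ?cp ?orbT //; split=> // a; rewrite inE.
  case/predU1P=> [-> lt_d|]; last exact: max_c.
  by move: nlt_d; rewrite lt_d.
- have [lt_d|nlt_d] := boolP (rX d.1 x).
    left; exists d; rewrite ?mem_head //; split=> // a; rewrite inE.
    by case/predU1P=> [->|/no_p/negPf-> //]; rewrite irr.
  by right=> a; rewrite inE => /predU1P[->|/no_p].
Qed.

Lemma no_min_lower_bound (y0 : Y) (p : seq (X * Y)) :
  no_min rY -> exists y, {in p, forall a, rY y a.2}.
Proof.
have [irr tr tot] := totY => nmin.
elim: p => [|d p [y lt_y]]; first by exists y0.
have [y1 lt_y1] := nmin y; have [y2 lt_y2] := nmin d.2.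
have [lt_yd|nlt_yd] := boolP (rY y d.2).
  exists y => a; rewrite inE => /predU1P[->|/lt_y] //.
exists y2 => a; rewrite inE => /predU1P[->|/lt_y lt_ya] //.
have /or3P[/eqP eq_y|lt|lt] := tot y d.2; last 2 first.
- by rewrite lt in nlt_yd.
- exact: tr lt_y2 (tr _ _ _ lt lt_ya).
- by rewrite eq_y in lt_ya; apply: tr lt_y2 lt_ya.
Qed.

Lemma partial_iso_between (p : seq (X * Y)) x y :
    partial_iso rX rY p -> {in p, forall a, a.1 != x} ->
    {in p, forall a, rX a.1 x -> rY a.2 y} ->
    {in p, forall a, rX x a.1 -> rY y a.2} ->
  partial_iso rX rY (rcons p (x, y)).
Proof.
have [irrX trX tot] := totX; have [irrY trY _] := totY.
move=> iso_p xNp lt_y gt_y; apply: partial_iso_rcons => // a ap /=.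
have asymX u v : rX u v -> rX v u = false.
  by move=> uv; apply/negP=> /(trX _ _ _ uv); rewrite irrX.
have asymY u v : rY u v -> rY v u = false.
  by move=> uv; apply/negP=> /(trY _ _ _ uv); rewrite irrY.
have /or3P[eq_ax|lt|lt] := tot a.1 x.
- by rewrite (negPf (xNp a ap)) in eq_ax.
- by have lt' := lt_y a ap lt; rewrite lt lt' (asymX _ _ lt) (asymY _ _ lt').
- by have lt' := gt_y a ap lt; rewrite lt lt' (asymX _ _ lt) (asymY _ _ lt').
Qed.

Lemma partial_iso_extend_old (p : seq (X * Y)) x :
    partial_iso rX rY p -> has (fun a => a.1 == x) p ->
  exists2 a, a \in p & a.1 = x /\ partial_iso rX rY (rcons p (x, a.2)).
Proof.
move=> iso_p /hasP[a ap /eqP eq_a]; exists a => //; split=> //.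
apply: partial_iso_sub iso_p => c; rewrite mem_rcons inE -eq_a.
by case/predU1P=> [->|//]; case: a ap {eq_a}.
Qed.

End Gaps.

(** What II needs, endpoints aside, against one more move on the left. Moves on the right are
    covered by the same condition on the swapped position. *)
Definition gaps_filled (X Y : eqType) (rX : rel X) (rY : rel Y)
    (p : seq (X * Y)) : Prop :=
  {in p &, forall a b x, rX a.1 x -> rX x b.1 ->
    exists y, rY a.2 y /\ rY y b.2}.

(** A new [x] is answered between the partners of its two neighbours in [p]. The upper neighbour is
    the lower one for the converse order. *)
Lemma extend_gaps_filled (X Y : eqType) (rX : rel X) (rY : rel Y)
    (p : seq (X * Y)) (y0 : Y) x :
    strict_total rX -> strict_total rY -> no_min rY -> no_max rY ->
    partial_iso rX rY p -> gaps_filled rX rY p ->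
  exists y, partial_iso rX rY (rcons p (x, y)).
Proof.
move=> totX totY nmin nmax iso_p gaps.
have [/(partial_iso_extend_old iso_p)[a _ [_ ?]]|xNp] :=
  boolP (has (fun a => a.1 == x) p); first by exists a.2.
have {}xNp : {in p, forall a, a.1 != x} by move=> a ap; apply: (hasPn xNp).
have totX' := @strict_total_converse _ rX (fun u v => rX v u)
  (fun _ _ => erefl) totX.
have totY' := @strict_total_converse _ rY (fun u v => rY v u)
  (fun _ _ => erefl) totY.
have [_ trX tX] := totX; have [_ trY tY] := totY.
have max_le a c : a \in p -> c \in p -> ~~ rX c.1 a.1 ->
    forall y, rY c.2 y -> rY a.2 y.
  move=> ap cp; rewrite (iso_p c a) // => nlt y lt_cy.
  have /or3P[/eqP->//|lt|lt] := tY a.2 c.2; first exact: trY lt lt_cy.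
  by rewrite lt in nlt.
have min_le a c : a \in p -> c \in p -> ~~ rX a.1 c.1 ->
    forall y, rY y c.2 -> rY y a.2.
  move=> ap cp; rewrite (iso_p a c) // => nlt y lt_yc.
  have /or3P[/eqP->//|lt|lt] := tY a.2 c.2; last exact: trY lt_yc lt.
  by rewrite lt in nlt.
(* Four cases: a neighbour on both sides uses the gap, one on a single side uses the absence of an
   endpoint, and with none any [y0] will do. *)
have [[c cp [lt_c max_c]]|no_c] := lower_neighbour totX p x;
have [[d dp [lt_d min_d]]|no_d] := lower_neighbour totX' p x.
- have [y [lt_cy lt_yd]] := gaps c d cp dp x lt_c lt_d.
  exists y; apply: partial_iso_between => // a ap lt.
    exact: max_le (max_c a ap lt) _ lt_cy.
  exact: min_le (min_d a ap lt) _ lt_yd.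
- have [y lt_cy] := nmax c.2.
  exists y; apply: partial_iso_between => // a ap lt.
    exact: max_le (max_c a ap lt) _ lt_cy.
  by rewrite (negPf (no_d a ap)) in lt.
- have [y lt_yd] := nmin d.2.
  exists y; apply: partial_iso_between => // a ap lt.
    by rewrite (negPf (no_c a ap)) in lt.
  exact: min_le (min_d a ap lt) _ lt_yd.
- exists y0; apply: partial_iso_between => // a ap lt.
    by rewrite (negPf (no_c a ap)) in lt.
  by rewrite (negPf (no_d a ap)) in lt.
Qed.

Lemma bf1_gaps_filled (X Y : eqType) (rX : rel X) (rY : rel Y)
    (p : seq (X * Y)) (x0 : X) (y0 : Y) :
    strict_total rX -> strict_total rY ->
    no_min rX -> no_max rX -> no_min rY -> no_max rY ->
    partial_iso rX rY p -> gaps_filled rX rY p ->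
    gaps_filled rY rX (map (@swap X Y) p) ->
  bf rX rY 1 p.
Proof.
move=> totX totY minX maxX minY maxY iso_p gapsX gapsY.
split=> //; split=> [x|y].
  have [y iso_y] := extend_gaps_filled y0 x totX totY minY maxY iso_p gapsX.
  by exists y.
have [x] := extend_gaps_filled x0 y totY totX minX maxX
  (partial_iso_swap iso_p) gapsY.
move/partial_iso_swap; rewrite map_rcons (mapK (@swapK X Y)).
by exists x.
Qed.

(** The first reply is arbitrary: a single pair bounds no interval, and both sides of it are
    nonempty in either order. *)
Lemma bf2_no_endpoints (X Y : eqType) (rX : rel X) (rY : rel Y)
    (x0 : X) (y0 : Y) :
    strict_total rX -> strict_total rY ->
    no_min rX -> no_max rX -> no_min rY -> no_max rY ->
  bf rX rY 2 [::].
Proof.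
move=> totX totY minX maxX minY maxY.
have [irrX trX _] := totX; have [irrY trY _] := totY.
have bf1 x y : bf rX rY 1 [:: (x, y)].
  apply: bf1_gaps_filled => // a b; rewrite !inE => /eqP-> /eqP-> /=.
  - by rewrite irrX irrY.
  - by move=> z lt1 /(trX _ _ _ lt1); rewrite irrX.
  - by move=> z lt1 /(trY _ _ _ lt1); rewrite irrY.
split=> //; split=> [x|y]; [exists y0 | exists x0]; exact: bf1.
Qed.

Lemma partial_iso_eq (X Y : eqType) (rX : rel X) (rY : rel Y) p :
    strict_total rX -> strict_total rY -> partial_iso rX rY p ->
  {in p &, forall a b, (a.1 == b.1) = (a.2 == b.2)}.
Proof.
move=> [irrX _ totX] [irrY _ totY] iso_p a b ap bp.
have ab := iso_p a b ap bp; have ba := iso_p b a bp ap.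
apply/eqP/eqP=> eq.
- move: ab ba; rewrite eq irrX => ab ba.
  by have /or3P[/eqP//||] := totY a.2 b.2; rewrite -?ab -?ba.
- move: ab ba; rewrite eq irrY => ab ba.
  by have /or3P[/eqP//||] := totX a.1 b.1; rewrite ?ab ?ba.
Qed.

Definition gap (T : Type) (r : rel T) (x y : T) : Prop :=
  exists z, r x z /\ r z y.

(** * Lower bound: a factor omega gains two moves *)

Section OmegaCopies.

Variables (X Y : eqType) (rX : rel X) (rY : rel Y).
Hypotheses (totX : strict_total rX) (totY : strict_total rY).

Local Notation position := (seq ((X * nat) * (Y * nat))).

Definition copies (a : (X * nat) * (Y * nat)) : X * Y := (a.1.1, a.2.1).

Definition same_offsets (q : position) : Prop :=
  {in q, forall a, a.1.2 = a.2.2}.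

(** Two points have room between them on both sides, or share a copy and have the same offsets on
    both sides. Unlike [same_offsets], this survives a reply to a point of a new copy, and it
    suffices for one last move. *)
Definition spread (q : position) : Prop :=
  {in q &, forall a b, lex rX ltn a.1 b.1 ->
    gap (lex rX ltn) a.1 b.1 /\ gap (lex rY ltn) a.2 b.2 \/
    [/\ a.1.1 = b.1.1, a.2.1 = b.2.1, a.1.2 = a.2.2 & b.1.2 = b.2.2]}.

Lemma spread_gaps_filled (q : position) :
  spread q -> gaps_filled (lex rX ltn) (lex rY ltn) q.
Proof.
have [irrX trX _] := totX.
have [_ trU _] := strict_total_lex totX strict_total_ltn.
move=> spread_q [[x i] [y i']] [[x1 j] [y1 j']] aq bq [z k] lt_az lt_zb.
have [[_]|] // := spread_q _ _ aq bq (trU _ _ _ lt_az lt_zb).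
case=> /= ? ? ? ?; subst x1 y1 i' j'; move: lt_az lt_zb; rewrite /lex /=.
case/orP=> [lt|/andP[/eqP<- lt_ik]].
  case/orP=> [/(trX _ _ _ lt)|/andP[/eqP eq]]; first by rewrite irrX.
  by rewrite eq irrX in lt.
rewrite irrX eqxx /= => lt_kj.
by exists (y, k); rewrite /lex /= eqxx lt_ik lt_kj !orbT.
Qed.

Lemma same_offsets_iso (q : position) :
    same_offsets q -> partial_iso rX rY (map copies q) ->
  partial_iso (lex rX ltn) (lex rY ltn) q.
Proof.
move=> off iso_q a b aq bq; rewrite /lex.
have aq' := map_f copies aq; have bq' := map_f copies bq.
rewrite (iso_q _ _ aq' bq') (partial_iso_eq totX totY iso_q aq' bq').
by rewrite !off.
Qed.

Lemma same_offsets_spread (q : position) :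
    same_offsets q -> partial_iso rX rY (map copies q) -> spread q.
Proof.
move=> off iso_q a b aq bq; have aq' := map_f copies aq.
have bq' := map_f copies bq; have iso_ab := iso_q _ _ aq' bq'.
case/orP=> [lt_ab|/andP[eq_ab _]]; [left | right].
  have lt_ab' := lt_ab; rewrite iso_ab in lt_ab'.
  split; [exists (a.1.1, a.1.2.+1) | exists (a.2.1, a.2.2.+1)].
  - by rewrite /lex /= eqxx ltnSn lt_ab orbT.
  - by rewrite /lex /= eqxx ltnSn lt_ab' orbT.
split; rewrite ?off //; apply/eqP => //.
by move: eq_ab; rewrite (partial_iso_eq totX totY iso_q aq' bq').
Qed.

Lemma offset_bound (q : position) : exists K, {in q, forall a, a.2.2 < K}.
Proof.
elim: q => [|c q [K lt_K]]; first by exists 0.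
exists (maxn K c.2.2.+1) => a; rewrite inE leq_max.
by case/predU1P=> [->|/lt_K->]; rewrite ?ltnSn ?orbT.
Qed.

(* A point of a fresh copy has both its gaps infinite, so its answer is put
   far up in the copy just below, or in a copy below everything. *)
Lemma omega_extend (q : position) (y0 : Y) z :
    no_min rY -> same_offsets q -> partial_iso rX rY (map copies q) ->
  exists z', partial_iso (lex rX ltn) (lex rY ltn) (rcons q (z, z')) /\
             spread (rcons q (z, z')).
Proof.
move=> nminY off iso_q; case: z => x k.
have [irrX trX tX] := totX; have [irrY trY tY] := totY.
(* A point of a copy already visited is answered in the partner copy, at the same offset. *)
have [old|new] := boolP (has (fun a => a.1 == x) (map copies q)).
  have [c _ [_ iso_c]] := partial_iso_extend_old iso_q old.
  have off' : same_offsets (rcons q ((x, k), (c.2, k))).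
    by move=> a; rewrite mem_rcons inE => /predU1P[->|/off].
  have iso' : partial_iso rX rY (map copies (rcons q ((x, k), (c.2, k)))).
    by rewrite map_rcons.
  by exists (c.2, k);
    split; [apply: same_offsets_iso | apply: same_offsets_spread].
have {}new : {in q, forall a, a.1.1 != x}.
  by move=> a aq; apply: (hasPn new (copies a)); apply: map_f.
have gap_lt a : a \in q -> lex rX ltn a.1 (x, k) ->
    rX a.1.1 x /\ gap (lex rX ltn) a.1 (x, k).
  move=> aq; rewrite /lex /= (negPf (new a aq)) orbF => lt_a; split=> //.
  by exists (a.1.1, a.1.2.+1); rewrite /= eqxx ltnSn lt_a orbT.
have gap_gt a : a \in q -> lex rX ltn (x, k) a.1 ->
    rX x a.1.1 /\ gap (lex rX ltn) (x, k) a.1.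
  move=> aq; rewrite /lex /= eq_sym (negPf (new a aq)) orbF => lt_a; split=> //.
  by exists (x, k.+1); rewrite /= eqxx ltnSn lt_a orbT.
have [z' [lt_z' gt_z']] : exists z',
    {in q, forall a, rX a.1.1 x -> gap (lex rY ltn) a.2 z'} /\
    {in q, forall a, rX x a.1.1 -> gap (lex rY ltn) z' a.2}.
  have [[c cq [lt_c max_c]]|no_c] := lower_neighbour totX (map copies q) x.
    (* [K] exceeds all offsets used on the right. With the reply at [K.+1], the point at [K]
       separates it from the old points below, and the point at [K.+2] from those above. *)
    have [K lt_K] := offset_bound q.
    exists (c.2, K.+1); split=> a aq lt_a; have aq' := map_f copies aq.
      exists (c.2, K); rewrite /lex /= eqxx ltnSn orbT lt_K // andbT.
      split=> //; have := max_c _ aq' lt_a; rewrite (iso_q _ _ cq aq').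
      rewrite /=.
      by have /or3P[/eqP->|->|->] := tY c.2 a.2.1; rewrite ?eqxx ?orbT.
    exists (c.2, K.+2); rewrite /lex /= eqxx ltnSn orbT.
    by rewrite -(iso_q _ _ cq aq') (trX _ _ _ lt_c lt_a).
  have [y lt_y] := no_min_lower_bound totY y0 (map copies q) nminY.
  exists (y, 0); split=> a aq lt_a; have aq' := map_f copies aq.
    by have := no_c _ aq'; rewrite lt_a.
  by exists (y, 1); rewrite /lex /= eqxx (lt_y _ aq') orbT.
have totU := strict_total_lex totX strict_total_ltn.
have totV := strict_total_lex totY strict_total_ltn.
have [irrU _ _] := totU; have [_ trV _] := totV.
have iso_U := same_offsets_iso off iso_q.
exists z'; split.
  apply: partial_iso_between => // a aq.
  - by apply: contraNneq (new a aq) => ->.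
  - by case/(gap_lt a aq) => /(lt_z' a aq)[w [lt1 lt2]] _; apply: trV lt1 lt2.
  - by case/(gap_gt a aq) => /(gt_z' a aq)[w [lt1 lt2]] _; apply: trV lt1 lt2.
have spread_q := same_offsets_spread off iso_q.
move=> a b; rewrite !mem_rcons !inE.
case/predU1P=> [->|aq] /predU1P[->|bq]; last exact: spread_q.
- by rewrite irrU.
- by case/(gap_gt b bq) => /(gt_z' b bq) ? ?; left.
- by case/(gap_lt a aq) => /(lt_z' a aq) ? ?; left.
Qed.

End OmegaCopies.

Lemma no_min_lex (X : eqType) (r : rel X) : no_min r -> no_min (lex r ltn).
Proof.
by move=> nmin [x i]; have [y lt_y] := nmin x; exists (y, 0); rewrite /lex lt_y.
Qed.

Lemma no_max_lex (X : eqType) (r : rel X) : no_max (lex r ltn).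
Proof. by move=> [x i]; exists (x, i.+1); rewrite /lex /= eqxx ltnSn orbT. Qed.

Section OmegaGame.

Variables (X Y : eqType) (rX : rel X) (rY : rel Y).
Hypotheses (totX : strict_total rX) (totY : strict_total rY).

Local Notation rU := (lex rX ltn).
Local Notation rV := (lex rY ltn).

Lemma spread_swap q : partial_iso rU rV q -> spread rX rY q ->
  spread rY rX (map (@swap _ _) q).
Proof.
move=> iso_q spread_q _ _ /mapP[a aq ->] /mapP[b bq ->] /=.
rewrite -(iso_q a b aq bq) => /(spread_q a b aq bq)[[? ?]|[]]; first by left.
by right.
Qed.

Lemma map_copies_swap q :
  map (@copies Y X) (map (@swap _ _) q) = map (@swap _ _) (map (@copies X Y) q).
Proof. by rewrite -!map_comp. Qed.

Lemma same_offsets_swap (q : seq ((X * nat) * (Y * nat))) :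
  same_offsets q -> same_offsets (map (@swap _ _) q).
Proof. by move=> off _ /mapP[a aq ->]; rewrite /= off. Qed.

Lemma bf1_spread (x0 : X) (y0 : Y) q : no_min rX -> no_min rY ->
  partial_iso rU rV q -> spread rX rY q -> bf rU rV 1 q.
Proof.
move=> minX minY iso_q spread_q.
apply: (bf1_gaps_filled (x0, 0) (y0, 0)) => //.
1,2: by apply: strict_total_lex => //; apply: strict_total_ltn.
1-4: by do [apply: no_min_lex | apply: no_max_lex].
- exact: spread_gaps_filled.
- exact/spread_gaps_filled/spread_swap.
Qed.

End OmegaGame.

(** For [n] rounds II answers in X and Y and copies the offset. Of the two remaining moves, the
    first is met by [omega_extend], which leaves a spread position, and the second by
    [bf1_spread]. *)
Lemma bf_omega (X Y : eqType) (rX : rel X) (rY : rel Y) (x0 : X) (y0 : Y) n q :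
    strict_total rX -> strict_total rY -> no_min rX -> no_min rY ->
    same_offsets q -> bf rX rY n (map (@copies X Y) q) ->
  bf (lex rX ltn) (lex rY ltn) n.+2 q.
Proof.
move=> totX totY minX minY.
elim: n q => [|n IHn] q off bf_q; have iso_q := bf_iso bf_q.
  have iso_U := same_offsets_iso totX totY off iso_q.
  split=> //; split=> z.
    have [z' [iso_z spread_z]] := omega_extend totX totY y0 z minY off iso_q.
    by exists z'; apply: bf1_spread.
  have := omega_extend totY totX x0 z minX (same_offsets_swap off).
  rewrite map_copies_swap => /(_ (partial_iso_swap iso_q))[z' [iso_z spread_z]].
  exists z'; apply: bf1_spread => //.
    by have := partial_iso_swap iso_z; rewrite map_rcons (mapK (@swapK _ _)).
  have := spread_swap iso_z spread_z.
  by rewrite map_rcons (mapK (@swapK _ _)).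
have iso_U := same_offsets_iso totX totY off iso_q.
have off' x y k : same_offsets (rcons q ((x, k), (y, k))).
  by move=> a; rewrite mem_rcons inE => /predU1P[->|/off].
case: bf_q => _ [forth back]; split=> //; split=> [[x k]|[y k]].
- have [y bf_y] := forth x; exists (y, k); apply: IHn => //.
  by rewrite map_rcons.
- have [x bf_x] := back y; exists (x, k); apply: IHn => //.
  by rewrite map_rcons.
Qed.

(** * Upper bound: a factor omega gains only two moves *)

(** A point below the start of a copy lies in a lower copy, and so does its successor. *)
Lemma immediate_pred_lex0 (X : eqType) (r : rel X) x :
  ~ exists z, immediate_pred (lex r ltn) z (x, 0).
Proof.
move=> [[z k] []]; rewrite {1}/lex /= andbF orbF => lt_zx /(_ (z, k.+1))[].
by rewrite /lex /= eqxx ltnSn lt_zx orbT.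
Qed.

Lemma immediate_pred_lexS (X : eqType) (r : rel X) x k : strict_total r ->
  exists z, immediate_pred (lex r ltn) z (x, k.+1).
Proof.
move=> [irr tr _]; exists (x, k); split.
  by rewrite /lex /= eqxx ltnSn orbT.
move=> [z j] []; rewrite /lex /= => /orP[lt|/andP[/eqP<- lt_kj]].
  by case/orP=> [/(tr _ _ _ lt)|/andP[/eqP eq]]; rewrite ?irr // eq irr in lt *.
by rewrite irr eqxx /= ltnS leqNgt lt_kj.
Qed.

(* The first points of the copies are the points without immediate
   predecessor, which two moves suffice to recognize. *)
Lemma bf_omega_inv (X Y : eqType) (rX : rel X) (rY : rel Y) n q :
    strict_total rX -> strict_total rY ->
    {in q, forall a, a.1.2 = 0 /\ a.2.2 = 0} ->
  bf (lex rX ltn) (lex rY ltn) n.+2 q -> bf rX rY n (map (@copies X Y) q).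
Proof.
move=> totX totY; elim: n q => [|n IHn] q off bf_q.
1,2: have iso_q : partial_iso rX rY (map (@copies X Y) q).
1,3: move=> _ _ /mapP[a aq ->] /mapP[b bq ->] /=.
1,2: have [a1 a2] := off a aq; have [b1 b2] := off b bq.
1,2: have := bf_iso bf_q aq bq; rewrite /lex a1 a2 b1 b2 /=.
1,2: by rewrite !andbF !orbF.
  by [].
split=> //; split=> [x|y].
(* I plays the start of copy [x]. A reply with positive offset has an immediate predecessor, and at
   least two moves remain to expose this. *)
- have [[y k] bf_y] := bf_forth (x, 0) bf_q; exists y.
  case: k bf_y => [|k] bf_y.
    move/IHn: bf_y; rewrite map_rcons; apply=> a.
    by rewrite mem_rcons inE => /predU1P[->|/off].
  case: (@immediate_pred_lex0 _ rX x).
  apply: (bf2_immediate_pred (p := rcons q ((x, 0), (y, k.+1)))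
                                (z' := (y, k.+1))).
  + exact: bf_le bf_y.
  + by rewrite mem_rcons inE eqxx.
  + exact: immediate_pred_lexS.
- have [[x k] bf_x] := bf_back (y, 0) bf_q; exists x.
  case: k bf_x => [|k] bf_x.
    move/IHn: bf_x; rewrite map_rcons; apply=> a.
    by rewrite mem_rcons inE => /predU1P[->|/off].
  case: (@immediate_pred_lex0 _ rY y).
  have bf2 : bf (lex rX ltn) (lex rY ltn) 2 (rcons q ((x, k.+1), (y, 0))).
    exact: bf_le bf_x.
  apply: (bf2_immediate_pred (bf_swap bf2) (z' := (x, k.+1))).
    by rewrite map_rcons mem_rcons inE eqxx.
  exact: immediate_pred_lexS.
Qed.

(** * Words in omega and its reverse *)

(* A word lists the factors of a product, innermost first; [true] stands for
   omega and [false] for its reverse. *)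
Fixpoint word (w : seq bool) : eqType :=
  if w is _ :: w' then (word w' * nat)%type else unit.

(** Reversing both orders when [k] is false turns an innermost factor of kind [k] into omega, so
    that both kinds are treated at once. *)
Definition toward (k : bool) (T : Type) (r : rel T) : rel T :=
  if k then r else fun x y => r y x.

Fixpoint wlt (w : seq bool) : rel (word w) :=
  if w is k :: w' return rel (word w) then lex (@wlt w') (toward k ltn)
  else fun _ _ => false.

Definition wbf (n : nat) (w v : seq bool) : Prop :=
  bf (@wlt w) (@wlt v) n [::].

Lemma word_inhabited w : word w.
Proof. by elim: w => [|k w x]; [exact: tt | exact: (x, 0)]. Qed.

Lemma strict_total_toward k (X : eqType) (r : rel X) :
  strict_total r -> strict_total (toward k r).
Proof. by case: k => //; apply: strict_total_converse. Qed.

Lemma strict_total_wlt w : strict_total (@wlt w).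
Proof.
elim: w => [|k w IHw]; first by split=> [[]|[]|[][]].
by apply/strict_total_lex/strict_total_toward/strict_total_ltn.
Qed.

Lemma bf_toward k (X Y : eqType) (rX : rel X) (rY : rel Y) n p :
  bf rX rY n p <-> bf (toward k rX) (toward k rY) n p.
Proof. by case: k => //; split; apply: bf_converse. Qed.

(** The converse of a lexicographic product is the product of the converses, and [bf] is unaffected
    by reversing both orders. *)
Lemma wbf_cons k n w v : wbf n (k :: w) (k :: v) <->
  bf (lex (toward k (@wlt w)) ltn) (lex (toward k (@wlt v)) ltn) n [::].
Proof.
by case: k => //; split; apply: bf_converse => x y; rewrite /= /lex eq_sym.
Qed.

(** One moves along the coordinate of a factor of kind [k]. For [k] false this says that there is no
    least element. *)
Lemma no_max_wlt k w : k \in w -> no_max (toward k (@wlt w)).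
Proof.
elim: w => // j w IHw; rewrite inE => /predU1P[<-|/IHw nmax] [x i].
  by exists (x, i.+1); case: k IHw; rewrite /= /lex /= eqxx ltnSn orbT.
by have [y lt_y] := nmax x; exists (y, 0); case: k lt_y {IHw nmax} => /= lt_y;
  rewrite /lex /= lt_y.
Qed.

Lemma no_min_wlt k w : ~~ k \in w -> no_min (toward k (@wlt w)).
Proof. by move/no_max_wlt; case: k. Qed.

(** The tuple of zeros is an endpoint when all letters are equal. *)
Lemma wlt_min k w : all (pred1 k) w ->
  exists x, forall y, ~~ toward k (@wlt w) y x.
Proof.
elim: w => [_|j w IHw /= /andP[/eqP-> /IHw[x min_x]]].
  by exists tt => y; case: k.
exists (x, 0) => -[y i]; have := min_x y.
by case: k {IHw min_x} => /= nlt; rewrite /lex /= (negPf nlt) andbF.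
Qed.

Lemma wbf1 w v : wbf 1 w v.
Proof.
have irr_w := let: And3 H _ _ := strict_total_wlt w in H.
have irr_v := let: And3 H _ _ := strict_total_wlt v in H.
have iso1 x y : partial_iso (@wlt w) (@wlt v) [:: (x, y)].
  by move=> a b; rewrite !inE => /eqP-> /eqP->; rewrite irr_w irr_v.
split=> //; split=> [x|y].
- by exists (word_inhabited v); split=> //; apply: iso1.
- by exists (word_inhabited w); split=> //; apply: iso1.
Qed.

(** I plays the endpoint of [w], then a point beyond II's reply in [v]. *)
Lemma not_wbf2 k w v : all (pred1 k) w -> ~~ k \in v -> ~ wbf 2 w v.
Proof.
move=> /wlt_min[x min_x] /no_min_wlt nmin /(bf_toward k)/(bf_forth x)[y].
have [y' lt_y'] := nmin y; move/(bf_back y')=> [x' [iso_p _]].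
have := iso_p (x', y') (x, y); rewrite /= !inE !eqxx ?orbT lt_y' => /(_ _ _).
by rewrite (negPf (min_x x')) => /(_ isT isT).
Qed.

Lemma wbf2 w v : true \in w -> false \in w -> true \in v -> false \in v ->
  wbf 2 w v.
Proof.
move=> /no_max_wlt wt /no_max_wlt wf /no_max_wlt vt /no_max_wlt vf.
apply: bf2_no_endpoints => //; try exact: strict_total_wlt.
all: exact: word_inhabited.
Qed.

Lemma immediate_pred_lex_gtn (X : eqType) (r : rel X) x k : strict_total r ->
  exists z, immediate_pred (lex r (fun i j => j < i)) z (x, k).
Proof.
move=> [irr tr _]; exists (x, k.+1); split.
  by rewrite /lex /= eqxx ltnSn orbT.
move=> [z j] []; rewrite /lex /= => /orP[lt|/andP[/eqP<- lt_jk]].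
  by case/orP=> [/(tr _ _ _ lt)|/andP[/eqP eq]]; rewrite ?irr // eq irr in lt *.
by rewrite irr eqxx /= ltnNge -ltnS lt_jk.
Qed.

(** I plays the start of a copy of omega, which has no immediate predecessor; in copies of the
    reverse of omega every point has one. *)
Lemma not_bf3_lex (X Y : eqType) (rX : rel X) (rY : rel Y) (x0 : X) :
    strict_total rY ->
  ~ bf (lex rX ltn) (lex rY (fun i j => j < i)) 3 [::].
Proof.
move=> totY /(bf_forth (x0, 0))[[y k] bf2].
apply: (@immediate_pred_lex0 _ rX x0).
apply: (bf2_immediate_pred bf2 (z' := (y, k))); first by rewrite inE eqxx.
exact: immediate_pred_lex_gtn.
Qed.

Lemma not_wbf3 k w v : ~ wbf 3 (k :: w) (~~ k :: v).
Proof.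
have totv := strict_total_wlt v; have x0 := word_inhabited w.
case: k => bf3; first exact: not_bf3_lex x0 totv bf3.
apply: (not_bf3_lex (rX := toward false (@wlt w)) x0
                    (strict_total_toward false totv)).
by apply: bf_converse bf3 => x y; rewrite /lex /= eq_sym.
Qed.

Lemma wbf_cat_inv P n w v :
  wbf (n + 2 * size P) (P ++ w) (P ++ v) -> wbf n w v.
Proof.
elim: P n => [|k P IHP] n; first by rewrite addn0.
rewrite /= mulnS addnCA => /wbf_cons.
move/(bf_omega_inv (strict_total_toward k (strict_total_wlt _))
                   (strict_total_toward k (strict_total_wlt _))).
by move=> bf_P; apply/IHP/(bf_toward k)/bf_P.
Qed.

(** Only the last letter of [P] needs a hypothesis. Once it is prepended, both words contain both
    letters, so the missing endpoints required by [bf_omega] are granted for all earlier letters. *)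
Lemma wbf_cat P n w v :
    (forall P' k, P = rcons P' k -> ~~ k \in w /\ ~~ k \in v) ->
  wbf n w v -> wbf (n + 2 * size P) (P ++ w) (P ++ v).
Proof.
elim/last_ind: P n w v => [|P k IHP] n w v; first by rewrite addn0.
move=> /(_ P k erefl)[kw kv] bf_wv.
rewrite size_rcons mulnS addnA !cat_rcons; apply: IHP => [P' j _|].
  by rewrite !inE; case: j; case: k kw kv => /= kw kv; rewrite ?kw ?kv.
apply/wbf_cons; rewrite addn2.
apply: bf_omega; try exact: word_inhabited.
1,2: exact/strict_total_toward/strict_total_wlt.
1,2: exact: no_min_wlt.
- by move=> a.
- exact: (proj1 (bf_toward k _ _ _ _) bf_wv).
Qed.

(** * Products of orders as words *)

Lemma rel_iso_refl (X : Type) (r : rel X) : rel_iso r r.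
Proof. by exists id, id. Qed.

Lemma rel_iso_sym (X Y : Type) (r : rel X) (s : rel Y) :
  rel_iso r s -> rel_iso s r.
Proof.
by case=> [f [g [fK gK fE]]]; exists g, f; split=> // x y; rewrite -fE !gK.
Qed.

Lemma rel_iso_trans (X Y Z : Type) (r : rel X) (s : rel Y) (t : rel Z) :
  rel_iso r s -> rel_iso s t -> rel_iso r t.
Proof.
case=> [f [g [fK gK fE]]] [f' [g' [f'K g'K f'E]]].
exists (f' \o f), (g \o g'); split; try exact: can_comp.
by move=> x y; rewrite /= f'E.
Qed.

Lemma rel_iso_lex (X Y X' Y' : eqType) (r : rel X) (s : rel Y)
    (r' : rel X') (s' : rel Y') :
  rel_iso r r' -> rel_iso s s' -> rel_iso (lex r s) (lex r' s').
Proof.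
case=> [f [g [fK gK fE]]] [f' [g' [f'K g'K f'E]]].
exists (fun a => (f a.1, f' a.2)), (fun a => (g a.1, g' a.2)).
split=> [[x y]|[x y]|[x y] [x1 y1]] /=; rewrite ?fK ?f'K ?gK ?g'K //.
by rewrite /lex /= fE f'E (can_eq fK).
Qed.

(** Associativity of the product, with [v] dominant because its factors are the outer ones. *)
Lemma rel_iso_word_cat w v :
  rel_iso (lex (@wlt v) (@wlt w)) (@wlt (w ++ v)).
Proof.
elim: w => [|k w IHw].
  exists fst, (fun x => (x, tt)); split=> [[x []]|x|[x i] [y j]] //=.
  by rewrite /lex /= andbF orbF.
apply: rel_iso_trans (rel_iso_lex IHw (rel_iso_refl (toward k ltn))).
exists (fun a => ((a.1, a.2.1), a.2.2)), (fun a => (a.1.1, (a.1.2, a.2))).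
split=> [[x [y i]]|[[x y] i]|[x [y i]] [x' [y' i']]] //=.
by rewrite /lex /= xpair_eqE andb_orr orbA andbA.
Qed.

Definition linorder_iso (X : linorder) w : Prop :=
  rel_iso (<%O : rel X) (@wlt w).

Lemma linorder_iso_lprod X Y w v :
  linorder_iso X w -> linorder_iso Y v -> linorder_iso (lprod X Y) (w ++ v).
Proof.
move=> isoX isoY; apply: rel_iso_trans (rel_iso_word_cat w v).
apply: rel_iso_trans (rel_iso_lex isoY isoX).
exists id, id; split=> // -[y x] [y' x']; rewrite /lex /=.
by rewrite ltEprodlexi /=; case: (ltgtP y y').
Qed.

Lemma linorder_iso_lprodn F (v : nat -> seq bool) k :
    (forall i, linorder_iso (F i) (v i)) ->
  linorder_iso (lprodn F k) (flatten (mkseq v k)).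
Proof.
move=> isoF; elim: k => [|k IHk].
  by exists (fun=> tt), (fun=> ord0); split=> [i|[]|i j] //;
    rewrite !ord1 ?ltxx.
by rewrite mkseqS flatten_rcons; apply: linorder_iso_lprod.
Qed.

Definition is_omega (k : omega_kind) : bool :=
  if k is Omega then true else false.

Lemma linorder_iso_omega_order k :
  linorder_iso (omega_order k) [:: is_omega k].
Proof. by case: k; exists (fun i => (tt, i)), snd; split=> // -[[]]. Qed.

Lemma linorder_iso_lpow k m :
  linorder_iso (lpow (omega_order k) m) (nseq m (is_omega k)).
Proof.
suff -> : nseq m (is_omega k) = flatten (mkseq (fun=> [:: is_omega k]) m).
  by apply: linorder_iso_lprodn => i; apply: linorder_iso_omega_order.
elim: m => // m IHm; rewrite mkseqS flatten_rcons -IHm.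
by rewrite -[in LHS]addn1 nseqD.
Qed.

Lemma is_l_wbf X Y w v n : linorder_iso X w -> linorder_iso Y v ->
  0 < n -> wbf n w v -> ~ wbf n.+1 w v -> is_l X Y n.
Proof.
move=> isoX isoY n_gt0 bf_n not_bf.
have [[_ [f _]] [_ [g _]]] := (isoX, isoY).
have [x0 y0] := (f (word_inhabited w), g (word_inhabited v)).
split=> //.
  apply/(EF_equiv_bf n x0 y0); apply: bf_rel_iso bf_n; exact: rel_iso_sym.
move/(EF_equiv_bf n.+1 x0 y0) => bf_n1; apply: not_bf; exact: bf_rel_iso bf_n1.
Qed.

(** * Exact values after a common prefix *)

(** [w] has an endpoint that [v] lacks, so the remainders have value 1. The last letter of [P] must
    differ from [k], the only letter of [w]. *)
Lemma wbf_const k P w v :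
    all (pred1 k) w -> k \in w -> k \in v -> ~~ k \in v ->
    (forall P' j, P = rcons P' j -> j = ~~ k) ->
  wbf (2 * size P + 1) (P ++ w) (P ++ v) /\
  ~ wbf (2 * size P + 1).+1 (P ++ w) (P ++ v).
Proof.
move=> all_w kw kv nkv lastP; rewrite addnC; split.
  by apply: wbf_cat (@wbf1 w v) => P' j /lastP->; rewrite negbK.
by rewrite -addSn => /wbf_cat_inv; apply: not_wbf2 all_w nkv.
Qed.

(** Both remainders contain both letters, hence have no endpoints, and two moves are safe. Their
    distinct first letters are exposed by a third. *)
Lemma wbf_heads k P w v :
    ~~ k \in w -> k \in v ->
  wbf (2 * size P + 2) (P ++ k :: w) (P ++ ~~ k :: v) /\
  ~ wbf (2 * size P + 2).+1 (P ++ k :: w) (P ++ ~~ k :: v).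
Proof.
move=> kw kv; have kw' : forall j, j \in k :: w.
  by move=> j; rewrite inE; case: j k kw {kv} => -[] //= ->; rewrite ?orbT.
have kv' : forall j, j \in ~~ k :: v.
  by move=> j; rewrite inE; case: j k kv {kw kw'} => -[] //= ->; rewrite ?orbT.
rewrite addnC; split.
  by apply: wbf_cat => //; apply: wbf2.
by rewrite -addSn => /wbf_cat_inv; apply: not_wbf3.
Qed.

Lemma wbf_sym n w v : wbf n w v -> wbf n v w.
Proof. exact: bf_swap. Qed.

(** * Words built from blocks of equal letters *)

Section Blocks.

Variable c : nat -> bool.

Definition blocks (f : nat -> nat) (lo len : nat) : seq bool :=
  flatten [seq nseq (f i) (c i) | i <- iota lo len].

Lemma blocks_cat f v s : v <= s ->
  blocks f 0 s = blocks f 0 v ++ blocks f v (s - v).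
Proof. by move=> /subnKC {1}<-; rewrite /blocks iotaD map_cat flatten_cat. Qed.

Lemma blocks_cons f lo len :
  blocks f lo len.+1 = nseq (f lo) (c lo) ++ blocks f lo.+1 len.
Proof. by []. Qed.

Lemma blocks1 f lo : blocks f lo 1 = nseq (f lo) (c lo).
Proof. exact: cats0. Qed.

Lemma eq_blocks f g v :
  (forall i, i < v -> f i = g i) -> blocks f 0 v = blocks g 0 v.
Proof.
move=> eq_fg; congr flatten; apply/eq_in_map => i.
by rewrite mem_iota => /eq_fg->.
Qed.

Lemma mem_blocks f lo len i : lo <= i < lo + len -> f i <> 0 ->
  c i \in blocks f lo len.
Proof.
move=> le_i /eqP f_i; apply/flattenP; exists (nseq (f i) (c i)).
  by apply: map_f; rewrite mem_iota.
by rewrite mem_nseq eqxx lt0n f_i.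
Qed.

Lemma size_blocks f v : size (blocks f 0 v) = \sum_(0 <= i < v) f i.
Proof.
elim: v => [|v IHv]; first by rewrite big_geq.
rewrite big_nat_recr //= -IHv (@blocks_cat _ v) // subSnn size_cat.
by rewrite blocks1 size_nseq.
Qed.

(** At block [u], the word of [g] runs out of letters first and passes to the opposite letter while
    that of [f] goes on. The bounds on [s] and [t] supply a later block with the letter that each
    remainder still lacks. *)
Lemma wbf_blocks_heads f g s t u :
    (forall i, i < u -> f i = g i) -> g u < f u ->
    c u.+1 = ~~ c u -> c u.+2 = c u ->
    u.+1 < s -> f u.+1 <> 0 -> u.+2 < t -> g u.+1 <> 0 -> g u.+2 <> 0 ->
  let N := 2 * (\sum_(0 <= i < u) f i + g u) + 2 in
  wbf N (blocks f 0 s) (blocks g 0 t) /\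
  ~ wbf N.+1 (blocks f 0 s) (blocks g 0 t).
Proof.
move=> eq_fg lt_gf cu1 cu2 lt_us f1 lt_ut g1 g2 N.
set P := blocks f 0 u ++ nseq (g u) (c u).
have -> : N = 2 * size P + 2 by rewrite size_cat size_blocks size_nseq.
have -> : blocks f 0 s =
    P ++ c u :: nseq (f u - g u).-1 (c u) ++ blocks f u.+1 (s - u).-1.
  rewrite (@blocks_cat _ u) ?(ltnW (ltnW lt_us)) //.
  have -> : s - u = (s - u).-1.+1 by lia.
  rewrite blocks_cons -{1}(subnKC (ltnW lt_gf)) nseqD /P -!catA.
  by have {1}-> : f u - g u = (f u - g u).-1.+1 by lia.
have -> : blocks g 0 t =
    P ++ ~~ c u :: nseq (g u.+1).-1 (c u.+1) ++ blocks g u.+2 (t - u).-2.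
  rewrite (@blocks_cat _ u) ?(ltnW (ltnW (ltnW lt_ut))) //.
  have -> : t - u = (t - u).-2.+2 by lia.
  rewrite !blocks_cons -cu1 /P -catA -(eq_blocks eq_fg).
  by have {1}-> : g u.+1 = (g u.+1).-1.+1 by lia.
apply: wbf_heads; rewrite mem_cat.
- by rewrite -cu1 mem_blocks ?orbT //; lia.
- by rewrite -cu2 mem_blocks ?orbT //; lia.
Qed.

End Blocks.

Lemma last_nseq_rcons (T : Type) (p q : seq T) d x y :
  d <> 0 -> p ++ nseq d x = rcons q y -> y = x.
Proof.
case: d => // d _ /(congr1 (last x)); rewrite last_rcons last_cat /= => <-.
by elim: d.
Qed.

(** * The first differing exponent and the case analysis *)

Lemma first_diff_le s m n : first_diff s m n <= s.
Proof. by rewrite -[leqRHS](size_iota 0 s); apply: find_size. Qed.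

Lemma first_diff_eq s m n i : i < first_diff s m n -> m i = n i.
Proof.
move=> lt_i; have lt_is := leq_trans lt_i (first_diff_le s m n).
by have := before_find 0 lt_i; rewrite nth_iota // => /negPn/eqP.
Qed.

Lemma first_diff_neq s m n : first_diff s m n < s ->
  m (first_diff s m n) <> n (first_diff s m n).
Proof.
move=> lt_s; have := lt_s; rewrite -[leqRHS](size_iota 0 s) -has_find.
by move/(nth_find 0); rewrite nth_iota // => /eqP.
Qed.

Theorem theorem3p5 (s t : nat) (M : nat -> omega_kind) (m n : nat -> nat)
    (hs : 1 <= s) (hst : s < t)
    (halt : forall i, i.+1 < t -> M i.+1 <> M i)
    (hm : forall i, i < s -> m i <> 0)
    (hn : forall j, j < t -> n j <> 0) :
  let A := lprodn (fun i => lpow (omega_order (M i)) (m i)) s in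
  let B := lprodn (fun j => lpow (omega_order (M j)) (n j)) t in
  let u := first_diff s m n in
  [/\ (* (i) *)
      (u = s \/ u = s - 1 ->
        is_l A B (2 * (\sum_(0 <= i < s - 1) m i) + 1)),
      (* (ii); u.+2 = s says u = s - 2 in the integers *)
      (u.+2 = s -> m (s - 2) < n (s - 2) ->
        is_l A B (2 * (\sum_(0 <= i < s - 2) m i + m (s - 2)) + 1)),
      (u.+2 = s -> n (s - 2) < m (s - 2) ->
        is_l A B (2 * (\sum_(0 <= i < s - 2) m i + n (s - 2)) + 2))
    & (* (iii) *)
      (u.+2 < s ->
        is_l A B (2 * (\sum_(0 <= i < u) m i + minn (m u) (n u)) + 2))].
Proof.
move=> A B u; pose c i := is_omega (M i).
have cS i : i.+1 < t -> c i.+1 = ~~ c i.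
  by move/halt; rewrite /c; case: (M i.+1); case: (M i).
have isoA : linorder_iso A (blocks c m 0 s).
  by apply: linorder_iso_lprodn => i; apply: linorder_iso_lpow.
have isoB : linorder_iso B (blocks c n 0 t).
  by apply: linorder_iso_lprodn => i; apply: linorder_iso_lpow.
have is_lP N : 0 < N -> wbf N (blocks c m 0 s) (blocks c n 0 t) /\
    ~ wbf N.+1 (blocks c m 0 s) (blocks c n 0 t) -> is_l A B N.
  by move=> N_gt0 [bfN not_bf]; apply: is_l_wbf isoA isoB N_gt0 bfN not_bf.
have eq_mn i : i < u -> m i = n i by apply: first_diff_eq.
have splitA v r : v <= s -> s - v = r.+1 -> blocks c m 0 s =
    blocks c m 0 v ++ nseq (m v) (c v) ++ blocks c m v.+1 r.
  by move=> le_vs eq_r; rewrite (@blocks_cat _ _ v) // eq_r.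
have splitB v r : v <= u -> v <= t -> t - v = r.+1 -> blocks c n 0 t =
    blocks c m 0 v ++ nseq (n v) (c v) ++ blocks c n v.+1 r.
  move=> le_vu le_vt eq_r; rewrite (@blocks_cat _ _ v) // eq_r.
  congr (_ ++ _); apply: eq_blocks => i lt_iv; apply/esym/eq_mn.
  exact: leq_trans lt_iv le_vu.
have all_nseq k d : all (pred1 k) (nseq d k).
  by rewrite all_nseq /= eqxx orbT.
have mem_nseq_neq0 d (k : bool) : d <> 0 -> k \in nseq d k.
  by rewrite mem_nseq eqxx; case: d.
split.
(* The common prefix is all blocks before [s - 1]. Then A has a single block left, whereas B also
   has block [s], of the opposite letter. *)
- move=> u_eq; have sE : s = (s - 1).+1 by lia.
  apply: is_lP; first by lia.
  have -> : blocks c m 0 s =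
      blocks c m 0 (s - 1) ++ nseq (m (s - 1)) (c (s - 1)).
    by rewrite (splitA (s - 1) 0) ?cats0 //; lia.
  rewrite (splitB (s - 1) (t - s)) -?(size_blocks c); try lia.
  apply: (@wbf_const (c (s - 1))) => //.
  + by apply: mem_nseq_neq0; apply: hm; lia.
  + by rewrite mem_cat mem_nseq_neq0 //; apply: hn; lia.
  + by rewrite -cS ?mem_cat ?mem_blocks ?orbT //; [lia | apply: hn; lia | lia].
  (* For [s = 1] the prefix is empty and has no last letter. *)
  + move=> P' j; case s2E : (s - 1) => [|v].
      by rewrite /blocks /=; case: P'.
    rewrite (@blocks_cat _ _ v) // subSnn blocks1.
    have mv : m v <> 0 by apply: hm; lia.
    move/(last_nseq_rcons mv)->.
    by rewrite cS ?negbK //; lia.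
(* A exhausts block [u] first and keeps only its last block, of one letter; B still has letters of
   block [u] and then block [u.+1]. *)
- move=> u_eq; have -> : s - 2 = u by lia.
  move=> lt_mn; apply: is_lP; first by lia.
  set P := blocks c m 0 u ++ nseq (m u) (c u).
  have -> : \sum_(0 <= i < u) m i + m u = size P.
    by rewrite size_cat size_blocks size_nseq.
  have -> : blocks c m 0 s = P ++ nseq (m u.+1) (c u.+1).
    by rewrite (splitA u 1) ?blocks1 ?catA //; lia.
  have -> : blocks c n 0 t =
      P ++ nseq (n u - m u) (c u) ++ blocks c n u.+1 (t - u).-1.
    rewrite (splitB u (t - u).-1); try lia.
    by rewrite -{1}(subnKC (ltnW lt_mn)) nseqD -!catA.
  apply: (@wbf_const (c u.+1)) => //.
  + by apply: mem_nseq_neq0; apply: hm; lia.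
  + by rewrite mem_cat mem_blocks ?orbT //; [lia | apply: hn; lia].
  + by rewrite cS ?negbK ?mem_cat ?mem_nseq_neq0 //; lia.
  + have mu : m u <> 0 by apply: hm; lia.
    move=> P' j /(last_nseq_rcons mu)->.
    by rewrite cS ?negbK //; lia.
(* Here B exhausts block [u] first; its block [u.+2 = s] exists since [s < t], so both remainders
   contain both letters. *)
- move=> u_eq; have -> : s - 2 = u by lia.
  move=> lt_nm; apply: is_lP; first by lia.
  apply: wbf_blocks_heads => //; rewrite ?cS ?negbK; try lia.
  1: by apply: hm; lia.
  1,2: by apply: hn; lia.
- move=> lt_us; apply: is_lP; first by lia.
  have [lt_mn|lt_nm|eq_u] := ltngtP (m u) (n u).
  (* The larger exponent belongs to B, so the roles are exchanged, and the sum of [n] below [u] is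
     rewritten as that of [m]. *)
  + have [] := @wbf_blocks_heads c n m t s u (fun i lt => esym (eq_mn i lt)).
    all: rewrite ?cS ?negbK //; try lia.
    all: try by apply: hm; lia.
    all: try by apply: hn; lia.
    rewrite (eq_big_nat _ _ (F2 := m)) => [bfN not_bf|i /andP[_ /eq_mn->] //].
    by split=> [|/wbf_sym]; [apply: wbf_sym|].
  + apply: wbf_blocks_heads => //; rewrite ?cS ?negbK; try lia.
    1: by apply: hm; lia.
    1,2: by apply: hn; lia.
  + by case: (@first_diff_neq s m n); first by lia.
Qed.
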